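(* Let $R$ be a unital $*$-ring and let $p,q\in R$ be projectors. Suppose that $p-q$, $p(1-q)$ and $q(1-p)$ are $*$-cancellable. Then the following conditions are equivalent: (1) $p-q\in R^\dag$; (2) $1-pq\in R^\dag$; (3) $p+q-pq\in R^\dag$.
   Context: A unital $*$-ring is an associative (not necessarily commutative) ring $R$ with unity $1$ and an involution $a\mapsto a^*$ satisfying $(a^* )^*=a$, $(a+b)^*=a^*+b^*$, $(ab)^*=b^*a^*$. An element $a\in R$ is MP-invertible if there is $b\in R$ with $aba=a$, $bab=b$, $(ab)^*=ab$, $(ba)^*=ba$; such $b$ is unique and denoted $a^\dag$ (the Moore-Penrose inverse). $R^\dag$ is the set of MP-invertible elements of $R$. An element $p\in R$ is a projector if $p^2=p=p^*$. An element $a\in R$ is $*$-cancellable if, for all $x\in R$, $a^*ax=0$ implies $ax=0$, and $xaa^*=0$ implies $xa=0$. *)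

(* Defs.v *)
From HB Require Import structures.
From mathcomp Require Import all_boot all_order all_algebra.

Set Implicit Arguments.
Unset Strict Implicit.
Unset Printing Implicit Defensive.

Import GRing.Theory.
Local Open Scope ring_scope.

(* Built on pzRingType, so that the zero ring (1 = 0) is not excluded. *)
HB.mixin Record PzRing_hasStar R of GRing.PzRing R := {
  star : R -> R;
  starK : involutive star;
  starD : {morph star : a b / a + b};
  starM : forall a b : R, star (a * b) = star b * star a
}.

#[short(type="starRingType")]
HB.structure Definition StarRing := { R of GRing.PzRing R & PzRing_hasStar R }.

Section StarRingNotions.

Variable R : starRingType.
Implicit Types a b p x : R.

Definition is_MP_inverse a b : Prop :=
  [/\ a * b * a = a, b * a * b = b, star (a * b) = a * b
    & star (b * a) = b * a].

Definition MP_invertible a : Prop := exists b, is_MP_inverse a b.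

Definition projector p : Prop := p ^+ 2 = p /\ p = star p.

Definition star_cancellable a : Prop :=
  forall x, (star a * a * x = 0 -> a * x = 0)
         /\ (x * a * star a = 0 -> x * a = 0).

End StarRingNotions.

(* Main.v *)
Require Import Defs.
From HB Require Import structures.
From mathcomp Require Import all_boot all_order all_algebra.

Set Implicit Arguments.
Unset Strict Implicit.
Unset Printing Implicit Defensive.

Import GRing.Theory.
Local Open Scope ring_scope.

(** Write [c = (p - q)^2]; it commutes with [p] and [q].

    If [b] is the Moore-Penrose inverse of [p - q], then [d = b^2] and
    [e = c d] commute with [p] and [q], and [p] and [q] agree on the range of
    [1 - e].  Since [1 - p q] is block triangular with respect to [p], with
    diagonal blocks [c p] and [1 - p], this gives its Moore-Penrose inverse
    [1 - p + d p (1 + q (1 - p))].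

    Conversely, let [x] be the Moore-Penrose inverse of [u = 1 - p q].
    Cancellability of [p (1 - q)] and [q (1 - p)] forces
    [1 - x u = 1 - u x = g], a projector below both [p] and [q].  Then [x p] and
    [q x] are inverses of [c p] and [c q] modulo [g], so [c] has the
    Moore-Penrose inverse [d = x p + (1 - p) (q x)^2 (1 - p)], and
    cancellability of [p - q] makes [d (p - q)] an inverse of [p - q].

    Finally [p + q - p q = 1 - (1 - p) (1 - q)], so the third condition is the
    second one for the complementary projectors. *)

Section Star.

Variable R : starRingType.
Implicit Types a b p q x : R.

(** * Involution, cancellability and negation *)

Lemma star0 : star 0 = 0 :> R.
Proof. by apply: (addrI (star (0 : R))); rewrite -starD !addr0. Qed.

Lemma starN a : star (- a) = - star a.
Proof. by apply/eqP; rewrite -addr_eq0 -starD addNr star0. Qed.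

Lemma starB a b : star (a - b) = star a - star b.
Proof. by rewrite starD starN. Qed.

Lemma star1 : star 1 = 1 :> R.
Proof. by rewrite -[LHS]mul1r -[X in X * _](@starK R) -starM mul1r starK. Qed.

(** The involution exchanges the left and right cancellation conditions. This transfers the
    hypotheses to the complementary projectors. *)
Lemma star_cancellable_star a : star_cancellable a -> star_cancellable (star a).
Proof.
move=> ca x; have [c1 c2] := ca (star x); rewrite starK.
split=> /(congr1 star); rewrite !starM ?starK star0 => h.
- by apply: (can_inj (@starK R)); rewrite starM starK star0 c2 // -mulrA.
- by apply: (can_inj (@starK R)); rewrite starM starK star0 c1 // -mulrA.
Qed.

Lemma star_cancellableN a : star_cancellable a -> star_cancellable (- a).
Proof.
move=> ca x; have [c1 c2] := ca x; rewrite starN !(mulNr, mulrN) !opprK.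
by split=> h; [rewrite (c1 h) | rewrite (c2 h)]; rewrite oppr0.
Qed.

Lemma MP_invertibleN a : MP_invertible a -> MP_invertible (- a).
Proof.
case=> b [h1 h2 h3 h4]; exists (- b).
by split; rewrite !(mulNr, mulrN) ?opprK ?h1 ?h2.
Qed.

Lemma projector_compl p : projector p -> projector (1 - p).
Proof.
case; rewrite /projector !expr2 => pp sp.
split; last by rewrite starB star1 -sp.
by rewrite mulrBl mul1r mulrBr mulr1 pp subrr subr0.
Qed.

(** * Commutation with generalized inverses *)

(** Adjoints of the Penrose equations let [star b] replace [b], and both products then equal
    [b * a * (a * b)]. *)
Lemma self_adjoint_MP_comm a b :
  star a = a -> is_MP_inverse a b -> a * b = b * a.
Proof.
move=> sa [h1 _ h3 h4].
have sba : star b * a = a * b by rewrite -h3 starM sa.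
have asb : a * star b = b * a by rewrite -h4 starM sa.
have asa : a * star b * a = a.
  by have := congr1 star h1; rewrite !starM sa mulrA.
transitivity (b * a * (a * b)); first by rewrite -asb mulrA asa.
by rewrite -sba -mulrA (mulrA a) asa.
Qed.

(** With [e = c d = d c], both [e p] and [p e] equal [e p e]; inserting [e] next to [d] then moves
    [p] across [d]. *)
Lemma group_inverse_comm (c d p : R) :
  c * d * c = c -> d * c * d = d -> c * d = d * c -> c * p = p * c ->
  d * p = p * d.
Proof.
move=> cdc dcd cd cp.
have ep : d * c * p = p * (d * c).
  transitivity (d * c * p * (d * c)).
  - by rewrite -(mulrA d c p) cp -!mulrA (mulrA c) cdc.
  - by rewrite -cd !mulrA -(mulrA _ p c) -cp !mulrA cdc.
rewrite -{1}dcd -(mulrA d c) cd -mulrA ep -cd (mulrA p c) -cp !mulrA ep.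
by rewrite -mulrA dcd.
Qed.

(** * The square of a difference of projectors *)

Lemma mul_proj_sqr_subl p q : p * p = p -> q * q = q ->
  p * ((p - q) * (p - q)) = p - p * q * p.
Proof.
move=> pp qq; rewrite !(mulrBl, mulrBr, mulrA) !pp -(mulrA p q q) qq.
by rewrite subrr subr0.
Qed.

Lemma mul_proj_sqr_subr p q : p * p = p -> q * q = q ->
  (p - q) * (p - q) * p = p - p * q * p.
Proof.
move=> pp qq; rewrite !(mulrBl, mulrBr) -!(mulrA _ p p) !pp qq.
by rewrite subrr subr0.
Qed.

Lemma mul_proj_compl p : p * p = p -> p * (1 - p) = 0.
Proof. by move=> pp; rewrite mulrBr mulr1 pp subrr. Qed.

Lemma mul_compl_proj p : p * p = p -> (1 - p) * p = 0.
Proof. by move=> pp; rewrite mulrBl mul1r pp subrr. Qed.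

(** * From [p - q] to [1 - p q] *)

Lemma MP_invertible_sub_mul p q : projector p -> projector q ->
  MP_invertible (p - q) -> MP_invertible (1 - p * q).
Proof.
case; rewrite expr2 => pp sp [+ sq]; rewrite expr2 => qq [b mpb].
have sa : star (p - q) = p - q by rewrite starB -sp -sq.
have ab := self_adjoint_MP_comm sa mpb; case: mpb => h1 h2 h3 h4.
pose c := (p - q) * (p - q); pose d := b * b; pose e := (p - q) * b.
have cd : c * d = e by rewrite -mulrA (mulrA _ b b) ab h2.
have dc : d * c = e by rewrite -(mulrA b b) (mulrA b (p - q)) -ab h1 -ab.
have cdc : c * d * c = c by rewrite cd /c /e mulrA h1.
have dcd : d * c * d = d by rewrite dc /d /e ab mulrA h2.
have cp : c * p = p - p * q * p by apply: mul_proj_sqr_subr.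
have pc : p * c = p - p * q * p by apply: mul_proj_sqr_subl.
have ea : e * (p - q) = p - q by [].
have ee : e * e = e by rewrite /e mulrA h1.
have se : star e = e by [].
clearbody c d e.
have cpC : c * p = p * c by rewrite cp.
have dp := group_inverse_comm cdc dcd (etrans cd (esym dc)) cpC.
have ep : e * p = p * e by rewrite -dc -mulrA cpC !mulrA dp.
have eq : e * q = e * p - (p - q) by rewrite -ea mulrBr subKr.
(* [w = p (1 - e)] is a projector absorbed by [p] and by [q], hence annihilated by [u]. It will be
   the common defect of [x u] and [u x]. *)
pose u := 1 - p * q; pose w := p - p * e.
have sw : star w = w by rewrite starB starM se -sp ep.
have wp : w * p = w by rewrite mulrBl -mulrA ep mulrA pp.
have wq : w * q = w.
  by rewrite mulrBl -mulrA eq !mulrBr ep mulrA pp opprB addrC addrAC subrK.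
have wu : w * u = 0 by rewrite mulrBr mulr1 mulrA wp wq subrr.
have pu : (1 - p) * u = 1 - p.
  by rewrite mulrBr mulr1 mulrA mul_compl_proj // mul0r subr0.
have up : u * p = p * c by rewrite mulrBl mul1r pc.
(* Inverse of a block triangular matrix: the off-diagonal block of [u] is [- p q (1 - p)], so that
   of [x] is [d p q (1 - p)]. *)
pose x := (1 - p) + d * p * (1 + q * (1 - p)).
have xu : x * u = 1 - w.
  have -> : x * u = (1 - p) * u + d * (p * (1 + q * (1 - p)) * u).
    by rewrite mulrDl -!mulrA.
  have -> : p * (1 + q * (1 - p)) * u = p * c.
    rewrite -mulrA mulrDl mul1r -(mulrA q) pu pc mulrDr !mulrBr !mulr1 !mulrA.
    by rewrite pp addrA subrK.
  by rewrite pu pc -cp mulrA dc ep opprB addrA addrAC.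
have ux : u * x = 1 - w.
  have -> : u * x = u * (1 - p) + u * p * d * (1 + q * (1 - p)).
    by rewrite mulrDr dp -!mulrA.
  have -> : u * p * d = p * e by rewrite up -mulrA cd.
  (* The difference of the two sides is [w q (1 - p) = w (1 - p) = 0]. *)
  have wqp : p * q * (1 - p) = p * e * (q * (1 - p)).
    apply/eqP; rewrite -subr_eq0 mulrA -!mulrBl -/w wq; apply/eqP.
    by rewrite mulrBr mulr1 wp subrr.
  rewrite (mulrDr (p * e)) mulr1 -wqp mulrBl mul1r addrACA addNr addr0.
  by rewrite opprB addrA [RHS]addrAC.
have xw : x * w = 0.
  have pw : p * w = w by rewrite mulrBr mulrA pp.
  have p'w : (1 - p) * w = 0 by rewrite mulrBl mul1r pw subrr.
  have ew : e * w = 0 by rewrite mulrBr mulrA ep -mulrA ee subrr.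
  have dw : d * w = 0 by rewrite -dcd -(mulrA d) cd -mulrA ew mulr0.
  have rw : (1 + q * (1 - p)) * w = w.
    by rewrite mulrDl mul1r -mulrA p'w mulr0 addr0.
  by rewrite mulrDl p'w add0r -(mulrA (d * p)) rw -mulrA pw.
exists x; rewrite -/u; split.
- by rewrite ux mulrBl mul1r wu subr0.
- by rewrite -mulrA ux mulrBr mulr1 xw subr0.
- by rewrite ux starB star1 sw.
- by rewrite xu starB star1 sw.
Qed.

(** * From [1 - p q] back to [p - q] *)

(** For [a = p (1 - q)], the hypotheses give [g a = g - g q] and [g a (star a) = (g - g q) p = 0];
    cancel [star a]. *)
Lemma star_cancellable_absorb g p q : projector p -> projector q ->
  star_cancellable (p * (1 - q)) -> g * p = g -> g * q * p = g -> g * q = g.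
Proof.
case; rewrite expr2 => pp sp [+ sq]; rewrite expr2 => qq cpq gp gqp.
have gpq' : g * (p * (1 - q)) = g - g * q by rewrite mulrA gp mulrBr mulr1.
apply/esym/eqP; rewrite -subr_eq0 -gpq'; apply/eqP.
have [_ can] := cpq g; apply: can.
rewrite gpq' starM starB star1 -sp -sq mulrA.
have -> : (g - g * q) * (1 - q) = g - g * q.
  by rewrite mulrBr mulr1 mulrBl -mulrA qq subrr subr0.
by rewrite mulrBl gp gqp subrr.
Qed.

Lemma MP_inverse_one_sub_mul p q x : projector p -> projector q ->
  star_cancellable (p * (1 - q)) -> star_cancellable (q * (1 - p)) ->
  is_MP_inverse (1 - p * q) x ->
  exists g, [/\ star g = g, g * p = g, g * q = g,
    (1 - p * q) * x = 1 - g & x * (1 - p * q) = 1 - g].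
Proof.
move=> hp hq cpq cqp [h1 h2 h3 h4].
case: (hp) (hq); rewrite expr2 => pp sp [+ sq]; rewrite expr2 => qq.
set u := 1 - p * q in h1 h2 h3 h4 *.
pose g := 1 - x * u; pose h := 1 - u * x.
have sg : star g = g by rewrite starB star1 h4.
have sh : star h = h by rewrite starB star1 h3.
have ug : u * g = 0 by rewrite mulrBr mulr1 mulrA h1 subrr.
have hu : h * u = 0 by rewrite mulrBl mul1r h1 subrr.
have pqg : p * q * g = g.
  by apply/esym/eqP; rewrite -subr_eq0 -[X in X - _]mul1r -mulrBl; apply/eqP.
have hpq : h * p * q = h.
  apply/esym/eqP; rewrite -subr_eq0 -mulrA -[X in X - _]mulr1 -mulrBr.
  exact/eqP.
have gqp : g * q * p = g.
  by have := congr1 star pqg; rewrite !starM sg -sp -sq mulrA.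
have gp : g * p = g by rewrite -{1}gqp -mulrA pp.
have gq : g * q = g by apply: (star_cancellable_absorb hp hq cpq).
have hq' : h * q = h by rewrite -{1}hpq -mulrA qq.
have hp' : h * p = h by apply: (star_cancellable_absorb hq hp cqp).
(* Absorption of [p] and [q] gives [g u = 0] and, after taking adjoints, [u h = 0]; so both defects
   equal [g h]. *)
have gh : g = h.
  have uh : u * h = 0.
    have su : star u = 1 - q * p by rewrite starB star1 starM -sp -sq.
    rewrite -sh -[u]starK -starM su mulrBr mulr1 mulrA hq' hp' subrr.
    exact: star0.
  have gu : g * u = 0 by rewrite mulrBr mulr1 mulrA gp gq subrr.
  transitivity (g * h).
  - by rewrite /h mulrBr mulr1 mulrA gu mul0r subr0.
  - by rewrite /g mulrBl mul1r -mulrA uh mulr0 subr0.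
exists g; split=> //; first by rewrite gh /h subKr.
by rewrite /g subKr.
Qed.

Lemma MP_invertible_sub_of_one_sub_mul p q : projector p -> projector q ->
  star_cancellable (p - q) ->
  star_cancellable (p * (1 - q)) -> star_cancellable (q * (1 - p)) ->
  MP_invertible (1 - p * q) -> MP_invertible (p - q).
Proof.
move=> hp hq ca cpq cqp [x mpx].
have [g [sg gp gq ux xu]] := MP_inverse_one_sub_mul hp hq cpq cqp mpx.
case: mpx => _ xux _ _; case: hp hq; rewrite expr2 => pp sp [+ sq].
rewrite expr2 => qq.
have pg : p * g = g by rewrite -[LHS]starK starM sg -sp gp sg.
have qg : q * g = g by rewrite -[LHS]starK starM sg -sq gq sg.
have gx : g * x = 0.
  by apply/oppr_inj/(addrI x); rewrite oppr0 addr0 -{3}xux xu mulrBl mul1r.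
have xg : x * g = 0.
  apply/oppr_inj/(addrI x).
  by rewrite oppr0 addr0 -{3}xux -mulrA ux mulrBr mulr1.
have pp' := mul_proj_compl pp; have p'p := mul_compl_proj pp.
have qq' := mul_proj_compl qq.
have sa : star (p - q) = p - q by rewrite starB -sp -sq.
pose c := (p - q) * (p - q).
have sc : star c = c by rewrite starM sa.
have cp : c * p = p - p * q * p by apply: mul_proj_sqr_subr.
have pc : p * c = p - p * q * p by apply: mul_proj_sqr_subl.
have qc : q * c = q - q * p * q.
  by rewrite /c -(opprB q p) mulrNN mul_proj_sqr_subl.
have cq : c * q = q - q * p * q.
  by rewrite /c -(opprB q p) mulrNN mul_proj_sqr_subr.
have cg : c * g = 0 by rewrite -mulrA (mulrBl g) pg qg subrr mulr0.
have p'c : (1 - p) * c = c * (1 - p) by rewrite mulrBl mulrBr mulr1 mul1r cp pc.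
have g_p' : g * (1 - p) = 0 by rewrite mulrBr mulr1 gp subrr.
have p'_g : (1 - p) * g = 0 by rewrite mulrBl mul1r pg subrr.
have cp' : c * (1 - p) = (1 - p) * q * (1 - p).
  have l : (1 - p) * (p - q) = - ((1 - p) * q) by rewrite mulrBr p'p sub0r.
  have r : (p - q) * (1 - p) = - (q * (1 - p)) by rewrite mulrBl pp' sub0r.
  have idem : (1 - p) * (1 - p) = 1 - p by rewrite {1}mulrBl mul1r pp' subr0.
  have -> : c * (1 - p) = (1 - p) * (p - q) * ((p - q) * (1 - p)).
    by rewrite -{1}idem mulrA -p'c /c !mulrA.
  by rewrite l r mulrNN -!mulrA (mulrA q q) qq.
have cE : (p - q) * (p - q) = c by [].
clearbody c.
(* Since [x] inherits [(1 - p) x = 1 - p] and [x (1 - q) = 1 - q] from [u], one gets [p y = y] and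
   [z q = z]. Hence [c y = u y] and [z c = z u]. *)
pose y := x * p; pose z := q * x.
have p'x : (1 - p) * x = 1 - p.
  have p'u : (1 - p) * (1 - p * q) = 1 - p.
    by rewrite mulrBr mulr1 mulrA p'p mul0r subr0.
  by rewrite -{1}p'u -mulrA ux mulrBr mulr1 p'_g subr0.
have xq' : x * (1 - q) = 1 - q.
  have uq' : (1 - p * q) * (1 - q) = 1 - q.
    by rewrite mulrBl mul1r -mulrA qq' mulr0 subr0.
  by rewrite -{1}uq' mulrA xu mulrBl mul1r mulrBr mulr1 gq subrr subr0.
have p'y : (1 - p) * y = 0 by rewrite mulrA p'x p'p.
have py : p * y = y.
  by apply/esym/eqP; rewrite -subr_eq0 -[X in X - _]mul1r -mulrBl p'y.
have zq : z * q = z.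
  by apply/esym/eqP; rewrite -subr_eq0 -{1}[z]mulr1 -mulrBr -mulrA xq' qq'.
have qz : q * z = z by rewrite mulrA qq.
have gy : g * y = 0 by rewrite mulrA gx mul0r.
have gz : g * z = 0 by rewrite mulrA gq gx.
have zg : z * g = 0 by rewrite -mulrA xg mulr0.
have cy : c * y = p - g.
  have -> : c * y = (1 - p * q) * y.
    by rewrite -{1}py mulrA cp !mulrBl mul1r -(mulrA (p * q)) py.
  by rewrite mulrA ux mulrBl mul1r gp.
have zc : z * c = q - g.
  have -> : z * c = z * (1 - p * q).
    by rewrite -{1}zq -mulrA qc !mulrBr mulr1 !mulrA zq.
  by rewrite -mulrA xu mulrBr mulr1 qg.
clearbody y z.
have spg : star (p - g) = p - g by rewrite starB sg -sp.
have sqg : star (q - g) = q - g by rewrite starB sg -sq.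
(* [y] equals [star y * c * y], which is self-adjoint because [c] is. *)
have sy : star y = y.
  have yE : y = star y * c * y.
    by rewrite -sc -starM cy spg mulrBl py gy subr0.
  by rewrite {1}yE !starM starK sc mulrA -yE.
have sz : star z = z.
  have zE : z = z * c * star z.
    by rewrite -mulrA -sc -starM zc sqg mulrBr zq zg subr0.
  by rewrite {1}zE !starM starK sc mulrA -zE.
have cz : c * z = q - g by rewrite -sqg -zc starM sz sc.
pose p' := 1 - p; rewrite -/p' in p'y p'c g_p' p'_g cp' pp' p'p.
have sp' : star p' = p' by rewrite starB star1 -sp.
have p'p' : p' * p' = p' by rewrite {1}/p' mulrBl mul1r pp' subr0.
(* Combine [z c z = z] with [c q = q (1 - p) q]. *)
have zp'z : z * p' * z = z.
  transitivity (z * c * z); last by rewrite zc mulrBl qz gz subr0.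
  have -> : z * c * z = z * (c * q) * z by rewrite -!mulrA qz.
  by rewrite /p' cq !(mulrBr z) mulr1 !mulrA zq !mulrBl -(mulrA _ q z) qz.
have pDp' : p + p' = 1 by rewrite addrC subrK.
clearbody p'.
(* Since [c] commutes with [p], it is inverted blockwise. On the block of [p'], [c z = q - g] gives
   [c p' z z p' = p' z p'], an idempotent by [zp'z]; [pi] is the resulting range projector of
   [c]. *)
pose d := y + p' * (z * z) * p'; pose pi := p - g + p' * z * p'.
have sd : star d = d by rewrite starD !starM sy sz sp' mulrA.
have spi : star pi = pi by rewrite starD spg !starM sz sp' mulrA.
have cd : c * d = pi.
  rewrite mulrDr cy !mulrA -p'c -(mulrA p') cz -(mulrA p') mulrBl qz gz.
  by rewrite subr0.
have dc : d * c = pi by rewrite -spi -cd starM sd sc.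
have cpi : c * pi = c.
  rewrite mulrDr mulrBr cg subr0 !mulrA -p'c -(mulrA p') cz mulrBr p'_g subr0.
  by rewrite -cp' -mulrDr pDp' mulr1.
have pid : pi * d = d.
  have piy : pi * y = y.
    by rewrite mulrDl mulrBl py gy subr0 -(mulrA (p' * z)) p'y mulr0 addr0.
  have pip' : pi * p' = p' * (z * p').
    by rewrite mulrDl mulrBl pp' g_p' subr0 add0r -!mulrA p'p'.
  have zp'zz : z * p' * (z * z) = z * z by rewrite mulrA zp'z.
  by rewrite mulrDr piy mulrA (mulrA pi) pip' -(mulrA p' _ (z * z)) zp'zz.
(* [c (1 - pi) = 0], and cancellability removes one factor [p - q] of [c]. *)
have api : (p - q) * pi = p - q.
  apply/esym/eqP; rewrite -subr_eq0 -[X in X - _]mulr1 -mulrBr; apply/eqP.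
  by case: (ca (1 - pi)) => + _; apply; rewrite sa cE mulrBr mulr1 cpi subrr.
exists (d * (p - q)); split.
- by rewrite -2!mulrA cE dc.
- by rewrite -(mulrA d) cE dc mulrA pid.
- by rewrite !starM sa sd mulrA.
- by rewrite -mulrA cE dc.
Qed.

End Star.

(** * The equivalence, by passing to complements *)

Theorem theorem3p3 (R : starRingType) (p q : R)
    (hp : projector p) (hq : projector q)
    (hpq : star_cancellable (p - q))
    (hp1q : star_cancellable (p * (1 - q)))
    (hq1p : star_cancellable (q * (1 - p))) :
  [<-> MP_invertible (p - q);
       MP_invertible (1 - p * q);
       MP_invertible (p + q - p * q)].
Proof.
have hp' := projector_compl hp; have hq' := projector_compl hq.
have subE : (1 - p) - (1 - q) = - (p - q).
  by rewrite !opprB addrC addrA subrK.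
have mulE : p + q - p * q = 1 - (1 - p) * (1 - q).
  by rewrite mulrBr mulr1 mulrBl mul1r opprB addrCA subKr -addrA addrC.
tfae.
- exact: MP_invertible_sub_mul.
- move=> mp; rewrite mulE; apply: MP_invertible_sub_mul => //; rewrite subE.
  by apply/MP_invertibleN/MP_invertible_sub_of_one_sub_mul.
- rewrite mulE => mp; rewrite -[p - q]opprK -subE; apply: MP_invertibleN.
  have sp : star p = p by case: hp.
  have sq : star q = q by case: hq.
  apply: MP_invertible_sub_of_one_sub_mul => //.
  - by rewrite subE; apply: star_cancellableN.
  (* For the complements, the product to be cancelled is [(1 - p) q], the adjoint of [q (1 - p)]. *)
  - have := star_cancellable_star hq1p.
    by rewrite subKr starM starB star1 sp sq.
  - have := star_cancellable_star hp1q.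
    by rewrite subKr starM starB star1 sp sq.
Qed.
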